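(* Let $f\ge2$, $l$ an odd prime with $l=ef+1$, $K$ a field with $\operatorname{char}K\nmid f!$, $\operatorname{char}K\ne l$, $\operatorname{Gal}(K(\zeta_l)/K)\simeq(\mathbb{Z}/l\mathbb{Z})^\times=\langle\gamma\rangle$, $\beta=\gamma^e$, $L=K(\zeta_l)$ and $M=L^{\langle\beta\rangle}$ (the fixed field of the subgroup generated by $\zeta_l\mapsto\zeta_l^\beta$, so $[L:M]=f$). Let $V\subset\mathbb{A}^{l-1}_K$ be the variety defined by $h_m({\bf x})=0$ ($m=1,\dots,e-1$) as in the context. For ${\bf x}\in V$ put $\alpha_{\bf x}=(-1)^{f-1}\sum_{i=1}^{l-1}x_i\zeta_l^i\in L$ and let $W=\{{\bf x}\in V\mid N_{L/K}(\alpha_{\bf x})\ne0\}$. Then $W$, equipped with the operation $\overset{-1}{\ast}$, is isomorphic (as an algebraic $K$-group) to the algebraic $K$-torus $$N_{L/M}^{-1}(\mathbb{G}_{m,K})=\{\alpha\in R_{L/K}(\mathbb{G}_m)\mid N_{L/M}(\alpha)\in\mathbb{G}_{m,K}\},$$ where $R_{L/K}$ is Weil restriction and $\mathbb{G}_{m,K}$ is regarded as the diagonal subtorus of $R_{M/K}(\mathbb{G}_m)$ induced by $K\subset M$.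
   Context: For $t\in\mathbb{Z}/l\mathbb{Z}$ let $T_t({\bf x})=\sum x_{i_0}x_{i_1}\cdots x_{i_{f-1}}$, the sum over $(i_0,\dots,i_{f-1})\in(\mathbb{Z}/l\mathbb{Z})^f$ with $i_0+\beta i_1+\cdots+\beta^{f-1}i_{f-1}\equiv t\pmod l$, with convention $x_0=0$; then $h_m({\bf x})=T_{\gamma^m}({\bf x})-T_{\gamma^{m+1}}({\bf x})$. The operation on $V$ is ${\bf x}\overset{-1}{\ast}{\bf y}=(z_1,\dots,z_{l-1})$ with $z_k=(-1)^{f-1}\big(\sum_{i=1}^{l-1}x_iy_{k-i}-\sum_{i=1}^{l-1}x_iy_{-i}\big)$ (subscripts mod $l$, $x_0=y_0=0$). *)

(* Defs.v *)
(* Affine K-groups are given by their functors of points on the category of   *)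
(* commutative K-algebras (comAlgType K).  Those algebras are nonzero by      *)
(* convention; this loses nothing, as every functor below has a single point  *)
(* over the zero ring.  By Yoneda, morphisms of K-schemes are the families of *)
(* maps that are natural in the algebra.                                      *)

From HB Require Import structures.
From mathcomp Require Import all_boot all_order all_algebra all_fingroup.
From mathcomp Require Import all_solvable all_field.
From mathcomp Require Import mpoly.

Set Implicit Arguments.
Unset Strict Implicit.
Unset Printing Implicit Defensive.

Import GRing.Theory.

Local Open Scope ring_scope.

(* comAlgType need not decide invertibility, hence no GRing.unit here. *)
Definition invertible (R : comNzRingType) (a : R) : Prop :=
  exists b : R, a * b = 1.

(* The tensor product A (x)_K L, in coordinates: with b = vbasis {:L}, the    *)
(* row vector u stands for \sum_i u_i (x) b_i.                                *)
Definition tens (K : fieldType) (L : fieldExtType K) (A : comAlgType K) : Type :=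
  'rV[A]_(\dim {:L}).

HB.instance Definition _ (K : fieldType) (L : fieldExtType K)
  (A : comAlgType K) := GRing.Lmodule.on (@tens K L A).

Section TensorRing.

Variables (K : fieldType) (L : fieldExtType K) (A : comAlgType K).

Local Notation T := (@tens K L A).
Local Notation b := (vbasis {:L}).

Implicit Types (u v w : T) (x y : L) (a : A).

(* x |-> 1 (x) x *)
Definition tens_in x : T := \row_i (coord b i x)%:A.

Definition tens_mul u v : T :=
  \sum_i \sum_j (u 0 i * v 0 j) *: tens_in (b`_i * b`_j).

Definition tens_one : T := tens_in 1.

Fact tens_in_additive : {morph tens_in : x y / x + y}.
Proof. by move=> x y; apply/rowP=> i; rewrite !mxE linearD /= scalerDl. Qed.

Fact tens_in0 : tens_in 0 = 0.
Proof. by apply/rowP=> i; rewrite !mxE linear0 scale0r. Qed.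

Fact tens_inZ (c : K) x : tens_in (c *: x) = c%:A *: tens_in x.
Proof.
by apply/rowP=> i; rewrite !mxE linearZ /= -scalerAl mul1r scalerA.
Qed.

Fact tens_in_sum (I : Type) (r : seq I) (F : I -> L) :
  tens_in (\sum_(i <- r) F i) = \sum_(i <- r) tens_in (F i).
Proof. exact: (big_morph tens_in tens_in_additive tens_in0). Qed.

Fact tens_in_basis (i : 'I_(\dim {:L})) : tens_in b`_i = delta_mx 0 i.
Proof.
apply/rowP=> j; rewrite !mxE eqxx /= coord_free.
  by rewrite eq_sym; case: eqP => _; rewrite ?scale1r ?scale0r.
exact: basis_free (vbasisP _).
Qed.

Fact tens_sum u : u = \sum_i u 0 i *: tens_in b`_i.
Proof.
rewrite [LHS]row_sum_delta; apply: eq_bigr => i _.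
by rewrite tens_in_basis.
Qed.

Fact tens_mulDl : left_distributive tens_mul +%R.
Proof.
move=> u v w; rewrite /tens_mul -big_split; apply: eq_bigr => i _ /=.
by rewrite -big_split; apply: eq_bigr => j _ /=; rewrite mxE mulrDl scalerDl.
Qed.

Fact tens_mulC : commutative tens_mul.
Proof.
move=> u v; rewrite /tens_mul exchange_big; apply: eq_bigr => i _ /=.
by apply: eq_bigr => j _ /=; rewrite mulrC [b`_i * _]mulrC.
Qed.

Fact tens_mulZl a u v : tens_mul (a *: u) v = a *: tens_mul u v.
Proof.
rewrite /tens_mul scaler_sumr; apply: eq_bigr => i _ /=.
by rewrite scaler_sumr; apply: eq_bigr => j _ /=; rewrite mxE scalerA mulrA.
Qed.

Fact tens_mulDr : right_distributive tens_mul +%R.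
Proof. by move=> u v w; rewrite !(tens_mulC u) tens_mulDl. Qed.

Fact tens_mulZr a u v : tens_mul u (a *: v) = a *: tens_mul u v.
Proof. by rewrite tens_mulC tens_mulZl tens_mulC. Qed.

Fact tens_mul0l v : tens_mul 0 v = 0.
Proof. by have := tens_mulZl 0 0 v; rewrite !scale0r. Qed.

Fact tens_mul_suml (I : Type) (r : seq I) (F : I -> T) v :
  tens_mul (\sum_(i <- r) F i) v = \sum_(i <- r) tens_mul (F i) v.
Proof.
apply: (big_morph (fun u : T => tens_mul u v)); last exact: tens_mul0l.
by move=> u w; apply: tens_mulDl.
Qed.

Fact tens_mul_sumr (I : Type) (r : seq I) (F : I -> T) v :
  tens_mul v (\sum_(i <- r) F i) = \sum_(i <- r) tens_mul v (F i).
Proof.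
by rewrite tens_mulC tens_mul_suml; apply: eq_bigr => i _; rewrite tens_mulC.
Qed.

Fact tens_in_mul x y : tens_in (x * y) = tens_mul (tens_in x) (tens_in y).
Proof.
rewrite {1}(coord_vbasis (memvf x)) {1}(coord_vbasis (memvf y)).
rewrite mulr_suml tens_in_sum; apply: eq_bigr => i _.
rewrite mulr_sumr tens_in_sum; apply: eq_bigr => j _.
rewrite -scalerAl -scalerAr scalerA tens_inZ !mxE.
by rewrite -scalerAl mul1r scalerA.
Qed.

Fact tens_mulA : associative tens_mul.
Proof.
move=> u v w.
rewrite (tens_sum u) (tens_mul_suml _ _ (tens_mul v w)).
rewrite (tens_mul_suml _ _ v) (tens_mul_suml _ _ w).
apply: eq_bigr => i _; rewrite !tens_mulZl; congr (_ *: _).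
rewrite (tens_sum v) (tens_mul_suml _ _ w) !tens_mul_sumr tens_mul_suml.
apply: eq_bigr => j _; rewrite !(tens_mulZl, tens_mulZr); congr (_ *: _).
rewrite (tens_sum w) (tens_mul_sumr _ _ (tens_in b`_j)).
rewrite (tens_mul_sumr _ _ (tens_in b`_i)) (tens_mul_sumr _ _ (tens_mul _ _)).
by apply: eq_bigr => k _; rewrite !tens_mulZr -!tens_in_mul mulrA.
Qed.

Fact tens_mul1 : left_id tens_one tens_mul.
Proof.
move=> u; rewrite {1}(tens_sum u) tens_mul_sumr [RHS]tens_sum.
by apply: eq_bigr => i _; rewrite tens_mulZr -tens_in_mul mul1r.
Qed.

Fact tens_one_neq0 : tens_one != 0.
Proof.
apply/negP => /eqP/rowP E; have /eqP[] := oner_neq0 L.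
rewrite (coord_vbasis (memvf (1 : L))) big1 // => i _.
have /eqP := E i; rewrite !mxE scaler_eq0 oner_eq0 orbF => /eqP->.
by rewrite scale0r.
Qed.

End TensorRing.

HB.instance Definition _ (K : fieldType) (L : fieldExtType K)
    (A : comAlgType K) :=
  GRing.Zmodule_isComNzRing.Build (@tens K L A) (@tens_mulA K L A)
    (@tens_mulC K L A) (@tens_mul1 K L A) (@tens_mulDl K L A)
    (@tens_one_neq0 K L A).

HB.instance Definition _ (K : fieldType) (L : fieldExtType K)
    (A : comAlgType K) :=
  GRing.Lmodule_isLalgebra.Build A (@tens K L A)
    (fun a u v => esym (@tens_mulZl K L A a u v)).

(* id (x) s, for a K-automorphism s of L *)
Definition tens_gal (K : fieldType) (L : splittingFieldType K)
    (A : comAlgType K) (s : gal_of {:L}) (u : tens L A) : tens L A :=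
  \sum_i u 0 i *: tens_in A (s (vbasis {:L})`_i).

(* The A-points of the norm N_{L/M}: galNorm, with the conjugations extended  *)
(* A-linearly to A (x)_K L.                                                   *)
Definition tens_norm (K : fieldType) (L : splittingFieldType K)
    (M : {vspace L}) (A : comAlgType K) (u : tens L A) : tens L A :=
  \prod_(s in 'Gal({:L} / M)%g) tens_gal s u.

(* Membership in G_{m,K}(A) = A^*, embedded in (A (x)_K L)^* by a |-> a (x) 1 *)
Definition in_Gm (K : fieldType) (L : fieldExtType K) (A : comAlgType K)
    (u : tens L A) : Prop :=
  exists2 a : A, invertible a & u = a%:A.

(* A functor of points embedded in affine space, with a binary operation *)
Record affine_magma (K : fieldType) := AffineMagma {
  adim : nat;
  apt : forall A : comAlgType K, 'rV[A]_adim -> Prop;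
  aop : forall A : comAlgType K, 'rV[A]_adim -> 'rV[A]_adim -> 'rV[A]_adim
}.
Arguments apt {K} G {A} x : rename.
Arguments aop {K} G {A} x y : rename.

(* Cut out by finitely many equations p = 0 and one inequation d <> 0, the    *)
(* latter meaning on A-points that the value of d is invertible.              *)
Definition locally_closed (K : fieldType) (G : affine_magma K) : Prop :=
  exists (eqs : seq {mpoly K[adim G]}) (d : {mpoly K[adim G]}),
  forall (A : comAlgType K) (x : 'rV[A]_(adim G)),
    let ev p := mmap (fun c : K => c%:A) (fun i => x 0 i) p : A in
    apt G x <-> (forall p, p \in eqs -> ev p = 0) /\ invertible (ev d).

Record algebraic_group (K : fieldType) (G : affine_magma K) : Prop := {
  algg_closed : locally_closed G;
  algg_nat : forall (A B : comAlgType K) (phi : {lrmorphism A -> B})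
      (x y : 'rV[A]_(adim G)), apt G x -> apt G y ->
    map_mx phi (aop G x y) = aop G (map_mx phi x) (map_mx phi y);
  algg_op : forall (A : comAlgType K) (x y : 'rV[A]_(adim G)),
    apt G x -> apt G y -> apt G (aop G x y);
  algg_assoc : forall (A : comAlgType K) (x y z : 'rV[A]_(adim G)),
    apt G x -> apt G y -> apt G z ->
    aop G x (aop G y z) = aop G (aop G x y) z;
  algg_unit : forall A : comAlgType K, exists e : 'rV[A]_(adim G),
    apt G e /\ forall x, apt G x ->
      [/\ aop G e x = x, aop G x e = x &
          exists y, [/\ apt G y, aop G x y = e & aop G y x = e]]
}.

(* The isomorphisms G_E -> H_E between the base changes to a K-algebra E.     *)
(* An E-algebra is a K-algebra A with a K-morphism iota : E -> A.             *)
Definition isomorphic_over (K : fieldType) (E : comAlgType K)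
    (G H : affine_magma K) : Prop :=
  exists (th : forall A : comAlgType K, {lrmorphism E -> A} ->
            'rV[A]_(adim G) -> 'rV[A]_(adim H))
         (et : forall A : comAlgType K, {lrmorphism E -> A} ->
            'rV[A]_(adim H) -> 'rV[A]_(adim G)),
  [/\ forall (A : comAlgType K) (iota : {lrmorphism E -> A}) x, apt G x ->
        apt H (th A iota x) /\ et A iota (th A iota x) = x,
      forall (A : comAlgType K) (iota : {lrmorphism E -> A}) y, apt H y ->
        apt G (et A iota y) /\ th A iota (et A iota y) = y,
      forall (A : comAlgType K) (iota : {lrmorphism E -> A}) x x',
        apt G x -> apt G x' ->
        th A iota (aop G x x') = aop H (th A iota x) (th A iota x') &
      forall (A B : comAlgType K) (iotaA : {lrmorphism E -> A})
          (iotaB : {lrmorphism E -> B}) (phi : {lrmorphism A -> B}),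
        (forall c, phi (iotaA c) = iotaB c) ->
        forall x, apt G x ->
        map_mx phi (th A iotaA x) = th B iotaB (map_mx phi x)].

Definition isomorphic (K : fieldType) (G H : affine_magma K) : Prop :=
  exists (th : forall A : comAlgType K, 'rV[A]_(adim G) -> 'rV[A]_(adim H))
         (et : forall A : comAlgType K, 'rV[A]_(adim H) -> 'rV[A]_(adim G)),
  [/\ forall (A : comAlgType K) (x : 'rV[A]_(adim G)), apt G x ->
        apt H (th A x) /\ et A (th A x) = x,
      forall (A : comAlgType K) (y : 'rV[A]_(adim H)), apt H y ->
        apt G (et A y) /\ th A (et A y) = y,
      forall (A : comAlgType K) (x x' : 'rV[A]_(adim G)),
        apt G x -> apt G x' ->
        th A (aop G x x') = aop H (th A x) (th A x') &
      forall (A B : comAlgType K) (phi : {lrmorphism A -> B})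
          (x : 'rV[A]_(adim G)), apt G x ->
        map_mx phi (th A x) = th B (map_mx phi x)].

Definition split_torus (K : fieldType) (r : nat) : affine_magma K :=
  @AffineMagma K r
    (fun A x => forall i, invertible (x 0 i))
    (fun A x y => \row_i (x 0 i * y 0 i)).

Definition algebraic_torus (K : fieldType) (G : affine_magma K) : Prop :=
  algebraic_group G /\
  exists (r : nat) (E : fieldExtType K), isomorphic_over E G (split_torus K r).

(* N_{L/M}^{-1}(G_{m,K}) inside R_{L/K}(G_m), with R_{L/K}(G_m)(A) the group  *)
(* of units of A (x)_K L                                                      *)
Definition norm_torus (K : fieldType) (L : splittingFieldType K)
    (M : {vspace L}) : affine_magma K :=
  @AffineMagma K (\dim {:L})
    (fun A (u : tens L A) => invertible u /\ in_Gm (tens_norm M u))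
    (fun A (u v : tens L A) => u * v).

(* x_k for k in Z/l, where x = (x_1, ..., x_(l-1)) and x_0 = 0 *)
Definition xcoord (l : nat) (R : comNzRingType) (x : 'rV[R]_l.-1)
    (k : 'Z_l) : R :=
  if (k : nat) is j.+1 then oapp (fun i : 'I_l.-1 => x 0 i) 0 (insub j) else 0.

Definition Tsum (f l : nat) (R : comNzRingType) (beta : {unit 'Z_l})
    (t : 'Z_l) (x : 'rV[R]_l.-1) : R :=
  \sum_(i : {ffun 'I_f -> 'Z_l} | \sum_(j < f) (val beta) ^+ j * i j == t)
    \prod_(j < f) xcoord x (i j).

Definition hpoly (e f l : nat) (R : comNzRingType) (gamma : {unit 'Z_l})
    (m : nat) (x : 'rV[R]_l.-1) : R :=
  let beta := (gamma ^+ e)%g in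
  Tsum f beta (val (gamma ^+ m)%g) x - Tsum f beta (val (gamma ^+ m.+1)%g) x.

Definition conv (f l : nat) (R : comNzRingType) (x y : 'rV[R]_l.-1) :
    'rV[R]_l.-1 :=
  \row_(k < l.-1) ((-1) ^+ f.-1 *
    (\sum_(i : 'Z_l | i != 0) xcoord x i * xcoord y (k.+1%:R - i)
     - \sum_(i : 'Z_l | i != 0) xcoord x i * xcoord y (- i))).

Definition alpha (f l : nat) (K : fieldType) (L : fieldExtType K) (zeta : L)
    (A : comAlgType K) (x : 'rV[A]_l.-1) : tens L A :=
  (-1) ^+ f.-1 * \sum_(i < l.-1) x 0 i *: tens_in A (zeta ^+ i.+1).

(* N_{L/K}(alpha) always lies in the image of A, so the open condition        *)
(* N_{L/K}(alpha) <> 0 reads on A-points as: it is an invertible element of A *)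
Definition W (e f l : nat) (gamma : {unit 'Z_l}) (K : fieldType)
    (L : splittingFieldType K) (zeta : L) : affine_magma K :=
  @AffineMagma K l.-1
    (fun A x => (forall m : nat, (1 <= m <= e.-1)%N -> hpoly e f gamma m x = 0)
                /\ in_Gm (tens_norm 1%VS (alpha f zeta x)))
    (fun A x y => conv f x y).

(* The fixed field of the subgroup generated by zeta |-> zeta ^+ beta *)
Definition fixed_by (K : fieldType) (L : splittingFieldType K) (zeta : L)
    (l : nat) (beta : {unit 'Z_l}) : {vspace L} :=
  fixedField <<[set s in 'Gal({:L} / 1) |
                 (s zeta == zeta ^+ (val beta : 'Z_l))%R]>>%g.

(* Main.v *)
(* Since zeta, ..., zeta^(l-1) is a basis of L/K, the map x |-> alpha_x is a
   linear isomorphism from affine (l-1)-space to R_{L/K}, and it turns the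
   operation of W into multiplication.  Expanding the product of conjugates gives
   N_{L/M}(alpha_x) = sum_t T_t(x) zeta^t = sum_(t <> 0) (T_t(x) - T_0(x)) zeta^t.
   This lies in the base ring iff the T_t with t <> 0 all agree, which, as
   T_(beta t) = T_t, is the system h_1 = ... = h_(e-1) = 0.  The same expansion
   for the whole Galois group gives N_{L/K}(alpha_x) = T'_0(x) - T'_1(x), with T'
   the sums of length l-1, so W is locally closed.  Hence alpha identifies W with
   the norm torus.  Over L the conjugations identify A (x) L with A^(l-1), and the
   torus becomes the group of unit vectors whose f-fold products over the classes
   mod e agree; solving for e-1 of the coordinates shows that it is split. *)

Require Import Defs.
From HB Require Import structures.
From mathcomp Require Import all_boot all_order all_algebra all_fingroup.
From mathcomp Require Import all_solvable all_field.
From mathcomp Require Import mpoly.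
From mathcomp Require Import zify.
From Stdlib Require Import ClassicalEpsilon.

Set Implicit Arguments.
Unset Strict Implicit.
Unset Printing Implicit Defensive.

Import GRing.Theory.
Local Open Scope ring_scope.

(** * Invertible elements, and products over a cyclic group *)

Lemma invertible1 (R : comNzRingType) : invertible (1 : R).
Proof. by exists 1; rewrite mulr1. Qed.

Lemma invertibleM (R : comNzRingType) (a b : R) :
  invertible a -> invertible b -> invertible (a * b).
Proof.
by move=> [a' aa'] [b' bb']; exists (a' * b'); rewrite mulrACA aa' bb' mulr1.
Qed.

Lemma invertibleMl (R : comNzRingType) (a b : R) :
  invertible (a * b) -> invertible a.
Proof. by move=> [c abc]; exists (b * c); rewrite mulrA. Qed.

Lemma invertible_prod (R : comNzRingType) (I : Type) (r : seq I) (P : pred I)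
    (F : I -> R) :
  (forall i, P i -> invertible (F i)) -> invertible (\prod_(i <- r | P i) F i).
Proof.
by move=> FU; elim/big_ind: _ => //; [exact: invertible1 | exact: invertibleM].
Qed.

Lemma invertible_rmorph (R S : comNzRingType) (phi : {rmorphism R -> S})
    (a : R) :
  invertible a -> invertible (phi a).
Proof. by move=> [b ab]; exists (phi b); rewrite -rmorphM ab rmorph1. Qed.

Lemma big_cycle (R : Type) (idx : R) (op : Monoid.com_law idx)
    (gT : finGroupType) (g : gT) (F : gT -> R) :
  \big[op/idx]_(h in <[g]>%g) F h = \big[op/idx]_(j < #[g]%g) F (g ^+ j)%g.
Proof.
have -> : <[g]>%g = [set (g ^+ j)%g | j : 'I_#[g]%g].
  apply/setP=> t; apply/idP/imsetP=> [/cyclePmin[j ltj ->]|[j _ ->]].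
    by exists (Ordinal ltj).
  exact: mem_cycle.
rewrite big_imset //= => i j _ _ /eqP; rewrite eq_expg_mod_order.
by rewrite !modn_small // => /eqP/val_inj.
Qed.

(** * Morphisms out of the tensor product *)

Section TensLift.

Variables (K : fieldType) (L : fieldExtType K) (A : comAlgType K).
Local Notation b := (vbasis {:L}).

Section Generic.

Variables (B : comNzRingType) (a : {rmorphism A -> B}) (g : {rmorphism L -> B}).
Hypothesis a_g : forall c : K, a c%:A = g c%:A.

(** The universal property of the tensor product: the morphism induced by [a] and [g], which agree
    on [K] by [a_g]. Scalar extension, conjugations and evaluations are instances. *)
Definition tens_lift (u : tens L A) : B := \sum_i a (u 0 i) * g b`_i.

Lemma tens_lift_zmod_morphism : zmod_morphism tens_lift.
Proof.
move=> u v; rewrite /tens_lift -sumrB; apply: eq_bigr => i _.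
by rewrite !mxE rmorphB mulrBl.
Qed.

HB.instance Definition _ :=
  GRing.isZmodMorphism.Build (tens L A) B tens_lift tens_lift_zmod_morphism.

Lemma tens_liftZ c u : tens_lift (c *: u) = a c * tens_lift u.
Proof.
rewrite /tens_lift mulr_sumr; apply: eq_bigr => i _.
by rewrite mxE rmorphM mulrA.
Qed.

Lemma tens_lift_in x : tens_lift (tens_in A x) = g x.
Proof.
rewrite /tens_lift {2}(coord_vbasis (memvf x)) rmorph_sum.
apply: eq_bigr => i _.
by rewrite mxE a_g -rmorphM mulr_algl.
Qed.

Lemma tens_lift_monoid_morphism : monoid_morphism tens_lift.
Proof.
split=> [|u v]; first by rewrite -(rmorph1 g) -tens_lift_in.
rewrite [u * v]/(tens_mul u v) /tens_mul raddf_sum /= /tens_lift mulr_suml.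
apply: eq_bigr => i _; rewrite -/(tens_lift _) raddf_sum mulr_sumr.
apply: eq_bigr => j _ /=; rewrite tens_liftZ tens_lift_in !rmorphM.
by rewrite mulrACA.
Qed.

End Generic.

Lemma tens_in_zmod_morphism : zmod_morphism (@tens_in K L A).
Proof.
move=> x y; rewrite tens_in_additive -scaleN1r tens_inZ.
by rewrite scaleN1r scaleNr scale1r.
Qed.

HB.instance Definition _ :=
  GRing.isZmodMorphism.Build L (tens L A) (@tens_in K L A)
    tens_in_zmod_morphism.

Lemma tens_in_monoid_morphism : monoid_morphism (@tens_in K L A).
Proof. by split=> // x y; exact: tens_in_mul. Qed.

HB.instance Definition _ :=
  GRing.isMonoidMorphism.Build L (tens L A) (@tens_in K L A)
    tens_in_monoid_morphism.

Lemma tens_in_alg (c : K) : tens_in A (c%:A : L) = (c%:A)%:A.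
Proof. by rewrite tens_inZ. Qed.

Lemma tens_scalerAr (a : A) (u v : tens L A) : a *: (u * v) = u * (a *: v).
Proof. by rewrite mulrC scalerAl mulrC. Qed.

Lemma tens_algE (a : A) i : (a%:A : tens L A) 0 i = a * (coord b i 1)%:A.
Proof. by rewrite !mxE. Qed.

(** The basis [vbasis {:L}] need not contain 1. A nonzero coordinate of 1 lets [a] be recovered from
    [a%:A] by reading that coordinate and dividing. *)
Lemma coord1_neq0 : exists i, coord b i (1 : L) != 0.
Proof.
apply/existsP/contraT; rewrite negb_exists => /forallP c0.
have /eqP[] := oner_neq0 L.
rewrite (coord_vbasis (memvf 1)) big1 // => i _.
by rewrite (eqP (negPn (c0 i))) scale0r.
Qed.

Lemma tens_alg_inj : injective (fun a : A => a%:A : tens L A).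
Proof.
have [i ci0] := coord1_neq0; move=> a a' /rowP/(_ i); rewrite !tens_algE.
move/(congr1 (fun x => x * ((coord b i 1)^-1)%:A)).
by rewrite -!mulrA !mulr_algl !scalerA !divff // !scale1r !mulr1.
Qed.

Lemma invertible_tens_alg (a : A) :
  invertible (a%:A : tens L A) <-> invertible a.
Proof.
split=> [[w]|[a' aa']]; last first.
  by exists a'%:A; rewrite mulr_algl scalerA aa' scale1r.
(* The same coordinate brings the inverse [w] down to [A]: it shows that [a * w 0 i] is a nonzero
   constant of [K]. *)
have [i ci0] := coord1_neq0; rewrite mulr_algl => /rowP/(_ i).
rewrite !mxE => awi; exists (w 0 i * ((coord b i 1)^-1)%:A).
by rewrite mulrA awi mulr_algl scalerA divff // scale1r.
Qed.

End TensLift.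

Section TensMap.

Variables (K : fieldType) (L : fieldExtType K) (A B : comAlgType K).
Variable phi : {lrmorphism A -> B}.

Definition tens_map (u : tens L A) : tens L B := map_mx phi u.

Lemma tens_mapE :
  tens_map =1 tens_lift (in_alg (tens L B) \o phi) (@tens_in K L B).
Proof.
move=> u; rewrite [LHS]tens_sum; apply: eq_bigr => i _ /=.
by rewrite mulr_algl mxE.
Qed.

Let phi_K (c : K) : (in_alg (tens L B) \o phi) c%:A = tens_in B (c%:A : L).
Proof. by rewrite /= tens_in_alg linearZ rmorph1. Qed.

Lemma tens_map_zmod_morphism : zmod_morphism tens_map.
Proof. by move=> u v; rewrite !tens_mapE raddfB. Qed.

Lemma tens_map_monoid_morphism : monoid_morphism tens_map.
Proof.
have [m1 mM] := tens_lift_monoid_morphism phi_K.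
by split=> [|u v]; rewrite !tens_mapE ?m1 ?mM.
Qed.

HB.instance Definition _ :=
  GRing.isZmodMorphism.Build (tens L A) (tens L B) tens_map
    tens_map_zmod_morphism.
HB.instance Definition _ :=
  GRing.isMonoidMorphism.Build (tens L A) (tens L B) tens_map
    tens_map_monoid_morphism.

End TensMap.

Section TensEval.

Variables (K : fieldType) (L : splittingFieldType K) (A : comAlgType K).
Variable iota : {lrmorphism L -> A}.

(** When L/K is Galois, these are the components of the splitting of A tensor L into copies of the
    L-algebra [A], indexed by the Galois group. *)
Definition tens_eval (s : gal_of {:L}) (u : tens L A) : A :=
  \sum_i u 0 i * iota (s (vbasis {:L})`_i).

Let eval_K (s : gal_of {:L}) (c : K) : c%:A = (iota \o s) (c%:A : L) :> A.
Proof. by rewrite /= !linearZ !rmorph1. Qed.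

Lemma tens_eval_in s x : tens_eval s (tens_in A x) = iota (s x).
Proof. exact: (@tens_lift_in K L A A idfun (iota \o s) (eval_K s)). Qed.

Lemma tens_evalZ s a u : tens_eval s (a *: u) = a * tens_eval s u.
Proof. exact: (@tens_liftZ K L A A idfun (iota \o s)). Qed.

Lemma tens_eval_zmod_morphism s : zmod_morphism (tens_eval s).
Proof. exact: (@tens_lift_zmod_morphism K L A A idfun (iota \o s)). Qed.

Lemma tens_eval_monoid_morphism s : monoid_morphism (tens_eval s).
Proof.
exact: (@tens_lift_monoid_morphism K L A A idfun (iota \o s) (eval_K s)).
Qed.

HB.instance Definition _ s :=
  GRing.isZmodMorphism.Build (tens L A) A (tens_eval s)
    (tens_eval_zmod_morphism s).
HB.instance Definition _ s :=
  GRing.isMonoidMorphism.Build (tens L A) A (tens_eval s)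
    (tens_eval_monoid_morphism s).

Lemma tens_eval_alg s a : tens_eval s a%:A = a.
Proof. by rewrite tens_evalZ rmorph1 mulr1. Qed.

End TensEval.

(** * Conjugations and norms on the tensor product *)

Section TensGal.

Variables (K : fieldType) (L : splittingFieldType K) (A : comAlgType K).
Implicit Types (s t : gal_of {:L}) (u : tens L A) (M : {vspace L}).

Lemma tens_galE s : @tens_gal K L A s =1
  @tens_lift K L A (tens L A) (in_alg (tens L A)) (@tens_in K L A \o s).
Proof. by move=> u; apply: eq_bigr => i _ /=; rewrite mulr_algl. Qed.

Let gal_K s (c : K) : in_alg (tens L A) c%:A = (@tens_in K L A \o s) c%:A.
Proof. by rewrite /= linearZ rmorph1 tens_in_alg. Qed.

Lemma tens_gal_in s x : tens_gal s (tens_in A x) = tens_in A (s x).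
Proof. by rewrite tens_galE tens_lift_in //; exact: gal_K. Qed.

Lemma tens_galZ s a u : tens_gal s (a *: u) = a *: tens_gal s u.
Proof. by rewrite !tens_galE tens_liftZ mulr_algl. Qed.

Lemma tens_gal_zmod_morphism s : zmod_morphism (@tens_gal K L A s).
Proof. by move=> u v; rewrite !tens_galE raddfB. Qed.

Lemma tens_gal_monoid_morphism s : monoid_morphism (@tens_gal K L A s).
Proof.
have [m1 mM] := tens_lift_monoid_morphism (gal_K s).
by split=> [|u v]; rewrite !tens_galE ?m1 ?mM.
Qed.

HB.instance Definition _ s :=
  GRing.isZmodMorphism.Build (tens L A) (tens L A) (@tens_gal K L A s)
    (tens_gal_zmod_morphism s).
HB.instance Definition _ s :=
  GRing.isMonoidMorphism.Build (tens L A) (tens L A) (@tens_gal K L A s)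
    (tens_gal_monoid_morphism s).

Lemma tens_gal1 u : tens_gal 1%g u = u.
Proof. by rewrite [RHS]tens_sum; apply: eq_bigr => i _; rewrite gal_id. Qed.

Lemma tens_galM s t u : tens_gal (s * t)%g u = tens_gal t (tens_gal s u).
Proof.
rewrite /tens_gal -/(tens_gal t _) raddf_sum; apply: eq_bigr => i _.
by rewrite /= tens_galZ tens_gal_in galM ?memvf.
Qed.

(** Products in [gal_of] apply the left factor first, so conjugation permutes the components by left
    translation. *)
Lemma tens_eval_gal (iota : {lrmorphism L -> A}) s t u :
  tens_eval iota t (tens_gal s u) = tens_eval iota (s * t)%g u.
Proof.
rewrite /tens_gal raddf_sum; apply: eq_bigr => i _.
by rewrite /= tens_evalZ tens_eval_in galM ?memvf.
Qed.

Lemma tens_normM M : {morph (@tens_norm K L M A) : u v / u * v}.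
Proof.
by move=> u v; rewrite -big_split; apply: eq_bigr => s _; rewrite rmorphM.
Qed.

Lemma tens_norm1 M : tens_norm M (1 : tens L A) = 1.
Proof. by rewrite /tens_norm big1 // => s _; rewrite rmorph1. Qed.

Lemma tens_gal_norm M s u :
  s \in 'Gal({:L} / M)%g -> tens_gal s (tens_norm M u) = tens_norm M u.
Proof.
move=> Gs; rewrite rmorph_prod /= /tens_norm [RHS](reindex_inj (mulIg s)) /=.
by apply: eq_big => [t|t _]; rewrite ?groupMr // tens_galM.
Qed.

(** An element is the factor at [1%g] of its own norm, hence divides it. *)
Lemma invertible_tens_norm M u : invertible (tens_norm M u) <-> invertible u.
Proof.
split=> [|uU]; last by apply: invertible_prod => s _; exact: invertible_rmorph.
by rewrite /tens_norm (bigD1 1%g) //= tens_gal1; exact: invertibleMl.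
Qed.

Lemma tens_norm_cycle M s u : 'Gal({:L} / M)%g = <[s]>%g ->
  tens_norm M u = \prod_(j < #[s]%g) tens_gal (s ^+ j)%g u.
Proof. by move=> defG; rewrite /tens_norm defG big_cycle. Qed.

End TensGal.

(** * The group law of the norm torus *)

Section NormTorus.

Variables (K : fieldType) (L : splittingFieldType K) (M : {vspace L}).

Lemma norm_torus_mul (A : comAlgType K) (u v : tens L A) :
  apt (norm_torus M) u -> apt (norm_torus M) v -> apt (norm_torus M) (u * v).
Proof.
move=> [uU [a aU Nu]] [vU [b bU Nv]]; split; first exact: invertibleM.
exists (a * b); first exact: invertibleM.
by rewrite tens_normM Nu Nv mulr_algl scalerA.
Qed.

(** Local closedness is left as a hypothesis: it will be transported from [W], whose points are
    given by explicit polynomials. *)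
Lemma norm_torus_algebraic_group :
  locally_closed (norm_torus M) -> algebraic_group (norm_torus M).
Proof.
split=> // [A B phi u v _ _ | A u v | A u v w _ _ _ | A].
- exact: (rmorphM (tens_map phi)).
- exact: norm_torus_mul.
- exact: (@mulrA (tens L A)).
exists (1 : tens L A); split.
  split; first exact: invertible1.
  by exists 1; [exact: invertible1 | rewrite tens_norm1 scale1r].
move=> u [[v uv] [a [b ab] Nu]].
split; [exact: (@mul1r (tens L A)) | exact: (@mulr1 (tens L A)) | exists v].
split=> //; last by rewrite -uv; exact: (@mulrC (tens L A)).
split; first by exists u; rewrite mulrC.
exists b; first by exists a; rewrite mulrC.
(* The inverse [v] has scalar norm [b], because a N(v) = N(u) N(v) = N(uv) = 1. *)
have <- : a *: tens_norm M v = 1.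
  by rewrite -mulr_algl -Nu -tens_normM uv tens_norm1.
by rewrite scalerA [b * a]mulrC ab scale1r.
Qed.

End NormTorus.

(** * Residues mod l *)

Section Zl.

(** The prime l is written [n.+2]: then ['Z_n.+2] is convertible to ['I_n.+2] and [n.+2.-1] to
    [n.+1], and the nonzero residues are the [lift ord0 i]. *)
Variable n : nat.
Hypothesis l_prime : prime n.+2.
Implicit Types (k : 'Z_n.+2) (g : {unit 'Z_n.+2}).

Lemma Zl_unit k : (k \is a GRing.unit) = (k != 0).
Proof.
have -> : (k \is a GRing.unit) = coprime n.+2 k by rewrite -unitZpE // natr_Zp.
rewrite prime_coprime //; case: k => [[|k] ltk] //=.
by rewrite gtnNdvd.
Qed.

Lemma Zl_unit_neq0 g : val g != 0.
Proof. by rewrite -Zl_unit; exact: valP. Qed.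

Lemma Zl_nat (i : 'I_n.+1) : (i.+1)%:R = lift ord0 i :> 'Z_n.+2.
Proof. by rewrite -[RHS](@natr_Zp n). Qed.

Lemma sum_Zl (V : zmodType) (F : 'Z_n.+2 -> V) :
  \sum_k F k = F 0 + \sum_(i < n.+1) F (lift ord0 i).
Proof. exact: big_ord_recl. Qed.

Variable gamma : {unit 'Z_n.+2}.
Hypothesis gamma_gen : <[gamma]>%g = units_Zp n.+2.

Lemma order_gamma : #[gamma]%g = n.+1.
Proof. by rewrite orderE gamma_gen card_units_Zp // totient_prime. Qed.

Lemma gamma_exp k : k != 0 -> exists m, k = val (gamma ^+ m)%g.
Proof.
rewrite -Zl_unit => Uk; have: Sub k Uk \in <[gamma]>%g by rewrite gamma_gen inE.
by case/cycleP=> m def_k; exists m; rewrite -def_k SubK.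
Qed.

Lemma sum_gamma (V : zmodType) (F : 'Z_n.+2 -> V) :
  \sum_(m < n.+1) F (val (gamma ^+ m)%g) = \sum_(k | k != 0) F k.
Proof.
transitivity (\sum_(m < #[gamma]%g) F (val (gamma ^+ m)%g)).
  by rewrite order_gamma.
rewrite -(big_cycle _ _ (fun g => F (val g))) gamma_gen.
(* [insubd] inverts [val]; its default [1%g] would be taken only at 0, which the sum omits. *)
rewrite [RHS](reindex_onto (val : {unit 'Z_n.+2} -> _)
  (insubd (1%g : {unit 'Z_n.+2}))) /=; last first.
  by move=> k; rewrite -Zl_unit => Uk; rewrite insubdK.
by apply: eq_bigl => g; rewrite inE Zl_unit_neq0 valKd eqxx.
Qed.

End Zl.

(** * Compatibility of T, h and the operation with ring morphisms *)

Section Coordinates.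

Variables (n : nat) (R S : comNzRingType) (phi : {rmorphism R -> S}).
Implicit Types (x y : 'rV[R]_n.+1) (g : {unit 'Z_n.+2}).

Lemma xcoord0 x : @xcoord n.+2 R x 0 = 0.
Proof. by []. Qed.

Lemma xcoord_lift x i : @xcoord n.+2 R x (lift ord0 i) = x 0 i.
Proof.
rewrite /xcoord -[nat_of_ord (lift ord0 i)]/i.+1 /=.
by case: insubP => [j _ /val_inj -> | /negP[]] //=.
Qed.

Lemma xcoord_map x k :
  @xcoord n.+2 S (map_mx phi x) k = phi (@xcoord n.+2 R x k).
Proof.
rewrite /xcoord; case: (k : nat) => [|j]; first by rewrite rmorph0.
by case: insub => [i|] /=; rewrite ?mxE ?rmorph0.
Qed.

Lemma Tsum_map f g t x :
  Tsum f g t (map_mx phi x : 'rV_n.+2.-1) = phi (Tsum f g t (x : 'rV_n.+2.-1)).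
Proof.
rewrite rmorph_sum; apply: eq_bigr => i _; rewrite rmorph_prod.
by apply: eq_bigr => j _; exact: xcoord_map.
Qed.

Lemma hpoly_map e f g m x :
  hpoly e f g m (map_mx phi x : 'rV_n.+2.-1) =
  phi (hpoly e f g m (x : 'rV_n.+2.-1)).
Proof. by rewrite rmorphB /= -!Tsum_map. Qed.

Lemma conv_map f x y :
  map_mx phi (conv f (x : 'rV_n.+2.-1) y) =
  conv f (map_mx phi x : 'rV_n.+2.-1) (map_mx phi y).
Proof.
apply/rowP=> k; rewrite !mxE rmorphM rmorphXn rmorphN1 rmorphB !rmorph_sum.
by congr (_ * (_ - _)); apply: eq_bigr => i _; rewrite rmorphM /= !xcoord_map.
Qed.

End Coordinates.

(** * Affine magmas *)

Section AffineMagmas.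

Variable K : fieldType.
Implicit Types G H : affine_magma K.

Lemma mpoly_eval_subst (m n : nat) (A : comAlgType K)
    (h : 'I_m -> {mpoly K[n]}) (x : 'I_n -> A) (p : {mpoly K[m]}) :
  mmap (in_alg A) x (mmap (in_alg {mpoly K[n]}) h p) =
  mmap (in_alg A) (fun i => mmap (in_alg A) x (h i)) p.
Proof.
rewrite [in RHS]/mmap [X in mmap _ _ X]/mmap rmorph_sum; apply: eq_bigr => q _.
rewrite rmorphM /= mmapZ rmorph1 mulr1; congr (_ * _).
by rewrite /mmap1 rmorph_prod; apply: eq_bigr => i _; rewrite rmorphXn.
Qed.

Lemma locally_closed_linear G H (P : 'M[K]_(adim H, adim G)) :
  (forall (A : comAlgType K) (u : 'rV[A]_(adim H)),
     apt H u <-> apt G (u *m map_mx (in_alg A) P)) ->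
  locally_closed G -> locally_closed H.
Proof.
move=> ptH [eqs [d ptG]].
pose h i : {mpoly K[adim H]} := \sum_j P j i *: 'X_j.
exists (map (mmap (in_alg {mpoly K[adim H]}) h) eqs).
exists (mmap (in_alg {mpoly K[adim H]}) h d) => A u /=.
have ev_sub p : mmap (in_alg A) (u 0) (mmap (in_alg {mpoly K[adim H]}) h p) =
    mmap (in_alg A) (fun i => (u *m map_mx (in_alg A) P) 0 i) p.
  rewrite mpoly_eval_subst; apply: eq_bigr => q _; congr (_ * _).
  apply: mmap1_eq => i.
  rewrite mxE rmorph_sum; apply: eq_bigr => j _.
  by rewrite /= mmapZ mmapX mmap1U mxE mulrC.
have [inv_sub sub_inv] : invertible (mmap (in_alg A) (u 0)
    (mmap (in_alg {mpoly K[adim H]}) h d)) <->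
    invertible (mmap (in_alg A) (fun i => (u *m map_mx (in_alg A) P) 0 i) d).
  by rewrite ev_sub.
rewrite ptH ptG; split=> -[eqs0 dU]; split; [|exact: sub_inv| |exact: inv_sub].
  by move=> _ /mapP[p eq_p ->]; rewrite [LHS]ev_sub; exact: eqs0.
move=> p eq_p; rewrite -[LHS](ev_sub p).
by apply: eqs0; exact: (map_f (mmap (in_alg {mpoly K[adim H]}) h)).
Qed.

(** The maps [th] are injective on points and multiplicative, so the group laws can be checked in
    [H]. That the operation preserves the points of [G] is not part of [isomorphic] and is
    assumed. *)
Lemma algebraic_group_isomorphic G H :
    locally_closed G ->
    (forall (A B : comAlgType K) (phi : {lrmorphism A -> B})
        (x y : 'rV[A]_(adim G)), apt G x -> apt G y ->
      map_mx phi (aop G x y) = aop G (map_mx phi x) (map_mx phi y)) ->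
    (forall (A : comAlgType K) (x y : 'rV[A]_(adim G)),
      apt G x -> apt G y -> apt G (aop G x y)) ->
  isomorphic G H -> algebraic_group H -> algebraic_group G.
Proof.
move=> clG natG opG [th [et [thP etP thM _]]] [_ _ opH assocH unitH].
have th_inj (A : comAlgType K) (x y : 'rV[A]_(adim G)) :
    apt G x -> apt G y -> th A x = th A y -> x = y.
  by move=> /thP[_ {2}<-] /thP[_ {2}<-] ->.
split=> // [A x y z xG yG zG | A].
  have [xyG yzG] := (opG A x y xG yG, opG A y z yG zG).
  apply: th_inj; [exact: opG | exact: opG | rewrite !thM //].
  have [[xH _] [yH _] [zH _]] := And3 (thP A x xG) (thP A y yG) (thP A z zG).
  exact: assocH.
have [e [eH eP]] := unitH A; have [eG the] := etP A e eH.
exists (et A e); split=> // x xG; have [xH _] := thP A x xG.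
have [ex xe [y [yH xy yx]]] := eP _ xH; have [yG thy] := etP A y yH.
split; [| |exists (et A y); split=> //];
  by apply: th_inj; rewrite ?thM ?the ?thy //; apply: opG.
Qed.

End AffineMagmas.

(** * The cyclotomic field *)

Section Cyclotomic.

Variables (n : nat) (K : fieldType) (L : splittingFieldType K) (zeta : L).
Hypothesis l_prime : prime n.+2.
Hypothesis char_l : n.+2 \notin [pchar K].
Hypothesis zeta_prim : n.+2.-primitive_root zeta.
Hypothesis L_gen : <<1; zeta>>%VS = fullv.
Local Notation b := (vbasis {:L}).
Implicit Types (k : 'Z_n.+2) (s t : gal_of {:L}).

Lemma natl_neq0 : n.+2%:R != 0 :> K.
Proof. by apply: contra char_l => l0; rewrite inE l_prime. Qed.

Lemma zetaD k k' : zeta ^+ (k + k' : 'Z_n.+2)%R = zeta ^+ k * zeta ^+ k'.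
Proof. by rewrite -exprD -(prim_expr_mod zeta_prim (k + k')). Qed.

Lemma zetaM k k' : zeta ^+ (k * k' : 'Z_n.+2)%R = (zeta ^+ k) ^+ k'.
Proof. by rewrite -exprM -(prim_expr_mod zeta_prim (k * k')). Qed.

Lemma zeta_eq1 k : (zeta ^+ k == 1) = (k == 0).
Proof.
rewrite -(prim_order_dvd zeta_prim); case: k => [[|k] ltk] //=.
by rewrite gtnNdvd.
Qed.

(** Orthogonality of characters: for [k != 0] the sum is geometric, and its product with
    [zeta ^+ k - 1] is zeta^(kl) - 1 = 0. *)
Lemma sum_zeta k : \sum_(j : 'Z_n.+2) zeta ^+ (j * k : 'Z_n.+2)%R
  = if k == 0 then n.+2%:R else 0.
Proof.
under eq_bigr do rewrite mulrC zetaM.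
case: eqVneq => [-> | k0].
  under eq_bigr do rewrite expr0 expr1n.
  by rewrite sumr_const card_ord.
apply/(mulfI (x := zeta ^+ k - 1)); first by rewrite subr_eq0 zeta_eq1.
rewrite mulr0 -[LHS](subrX1 _ n.+2) exprAC (prim_expr_order zeta_prim) expr1n.
exact: subrr.
Qed.

Lemma gal_zeta_inj s t : s zeta = t zeta -> s = t.
Proof.
move=> st; apply/eqP/gal_eqP => x _.
have : x \in <<1; zeta>>%VS by rewrite L_gen memvf.
case/Fadjoin1_polyP => p ->; rewrite -!horner_map /= st; congr _.[_].
apply/polyP=> i; rewrite !coef_map /= !linearZ /=.
by rewrite !rmorph1.
Qed.

Lemma gal_zeta s :
  exists g : {unit 'Z_n.+2}, s zeta = zeta ^+ (val g : 'Z_n.+2).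
Proof.
have : s zeta ^+ n.+2 = 1.
  by rewrite -rmorphXn (prim_expr_order zeta_prim) rmorph1.
case/(prim_rootP zeta_prim) => i def_i.
suff Ui : (i : 'Z_n.+2) \is a GRing.unit.
  by exists (Sub (i : 'Z_n.+2) Ui); rewrite SubK.
rewrite Zl_unit //; apply/eqP => i0; move: def_i; rewrite i0 expr0.
rewrite -(rmorph1 s) => /fmorph_inj/eqP.
by rewrite -[zeta]expr1 -(prim_order_dvd zeta_prim) gtnNdvd.
Qed.

Lemma galX_zeta s (g : {unit 'Z_n.+2}) j :
  s zeta = zeta ^+ (val g : 'Z_n.+2) ->
  (s ^+ j)%g zeta = zeta ^+ (val (g ^+ j)%g : 'Z_n.+2).
Proof.
move=> s_zeta; elim: j => [|j IHj]; first by rewrite !expg0 gal_id expr1.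
by rewrite expgSr galM ?memvf // IHj rmorphXn /= s_zeta -zetaM [in RHS]expgS.
Qed.

Lemma order_gal s (g : {unit 'Z_n.+2}) :
  s zeta = zeta ^+ (val g : 'Z_n.+2) -> #[s]%g = #[g]%g.
Proof.
move=> s_zeta; have sg1 j : ((s ^+ j)%g == 1%g) = ((g ^+ j)%g == 1%g).
  apply/eqP/eqP => [s1 | g1].
    move: (galX_zeta j s_zeta); rewrite s1 gal_id -{1}[zeta]expr1 => /eqP.
    rewrite (eq_prim_root_expr zeta_prim) eq_sym => /eqP.
    rewrite !modn_small ?ltn_ord // => gj; apply/val_inj/val_inj; exact: gj.
  by apply: gal_zeta_inj; rewrite (galX_zeta j s_zeta) g1 gal_id expr1.
apply/eqP; rewrite eqn_dvd !order_dvdn sg1 expg_order eqxx.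
by rewrite -(sg1 #[s]%g) expg_order eqxx.
Qed.

Variable gamma : {unit 'Z_n.+2}.
Hypothesis gamma_gen : <[gamma]>%g = units_Zp n.+2.

(** [Gal_L] is an abstract isomorphism, unrelated to the action on [zeta]. The cyclotomic character
    [f] is injective, hence bijective by counting, and the preimage of [gamma] generates because it
    has the same order as [gamma]. *)
Lemma gal_gamma (Gal_L : ('Gal({:L} / 1) \isog units_Zp n.+2)%g) :
  exists s : gal_of {:L},
  s zeta = zeta ^+ (val gamma : 'Z_n.+2) /\ ('Gal({:L} / 1) = <[s]>)%g.
Proof.
pose f s : {unit 'Z_n.+2} :=
  odflt 1%g [pick g : {unit 'Z_n.+2} | s zeta == zeta ^+ (val g : 'Z_n.+2)].
have fP s : s zeta = zeta ^+ (val (f s) : 'Z_n.+2).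
  rewrite /f; case: pickP => [g /eqP // | no_g].
  by have [g /eqP] := gal_zeta s; rewrite no_g.
have f_inj : injective f.
  by move=> s t fst; apply: gal_zeta_inj; rewrite !fP fst.
have : gamma \in f @: 'Gal({:L} / 1)%g.
  suff -> : f @: 'Gal({:L} / 1)%g = units_Zp n.+2 by rewrite inE.
  apply/eqP; rewrite eqEcard (card_imset _ f_inj) (card_isog Gal_L) leqnn.
  by rewrite andbT subsetT.
case/imsetP => s Gs def_g; exists s.
have s_zeta : s zeta = zeta ^+ (val gamma : 'Z_n.+2) by rewrite def_g.
split=> //; apply/eqP; rewrite eq_sym eqEcard cycle_subG Gs /=.
by rewrite (card_isog Gal_L) -orderE (order_gal s_zeta) orderE gamma_gen.
Qed.

Variable s0 : gal_of {:L}.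
Hypothesis s0_zeta : s0 zeta = zeta ^+ (val gamma : 'Z_n.+2).

(** * The powers of zeta as a basis of L, and the matrix of conjugates *)

Definition zeta_mx : 'M[K]_(n.+1, \dim {:L}) :=
  \matrix_(i, j) coord b j (zeta ^+ i.+1).

Definition gal_mx : 'M[L]_(\dim {:L}, n.+1) :=
  \matrix_(i, m) (s0 ^+ m)%g b`_i.

Definition fourier_mx : 'M[L]_n.+1 :=
  \matrix_(i, m) (s0 ^+ m)%g (zeta ^+ i.+1).

(* Up to the factor l, the inverse of [fourier_mx]: subtracting 1 from
   [zeta ^- (j k)] makes the missing term [k = 0] of the sum over Z/l vanish. *)
Definition fourier_inv : 'M[L]_n.+1 :=
  \matrix_(m, j) (zeta ^+ (- (lift ord0 j : 'Z_n.+2) *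
                           val (gamma ^+ m)%g : 'Z_n.+2)%R - 1).

(** With i and j read as nonzero residues, the entry is the sum over k of zeta^(k(i-j)) - zeta^(ki).
    By [sum_zeta] the second part is 0, as i is nonzero, and the first is l on the diagonal and 0
    elsewhere. *)
Lemma fourierK : fourier_mx *m fourier_inv = n.+2%:R%:M.
Proof.
apply/matrixP=> i j; rewrite !mxE.
pose F (k : 'Z_n.+2) : L := zeta ^+ (k * (lift ord0 i - lift ord0 j) : 'Z_n.+2)%R
  - zeta ^+ (k * lift ord0 i : 'Z_n.+2)%R.
transitivity (\sum_(k | k != 0) F k).
  rewrite -(sum_gamma l_prime gamma_gen F); apply: eq_bigr => m _.
  have -> : fourier_mx i m =
      zeta ^+ (lift ord0 i * val (gamma ^+ m)%g : 'Z_n.+2)%R.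
    by rewrite mxE zetaM rmorphXn /= (galX_zeta m s0_zeta) exprAC.
  by rewrite mxE mulrBr mulr1 -zetaD -mulrDl /F !(mulrC (val _)).
transitivity (\sum_k F k).
  by rewrite [RHS](bigD1 0) //= {2}/F !mul0r subrr add0r.
rewrite sumrB !sum_zeta subr_eq0 (inj_eq lift_inj) /= subr0.
by case: eqP.
Qed.

Lemma natl_neq0L : n.+2%:R != 0 :> L.
Proof. by rewrite -(rmorph_nat (in_alg L)) fmorph_eq0 natl_neq0. Qed.

Lemma zeta_gal_mx : map_mx (in_alg L) zeta_mx *m gal_mx = fourier_mx.
Proof.
apply/matrixP=> i m; rewrite !mxE.
rewrite [in RHS](coord_vbasis (memvf (zeta ^+ i.+1))) rmorph_sum.
by apply: eq_bigr => k _; rewrite !mxE /= linearZ mulr_algl.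
Qed.

(** zeta is a root of 1 + X + ... + X^(l-1). Irreducibility is not proved here: the opposite
    inequality comes from [zeta_mx_free]. *)
Lemma dim_L_le : (\dim {:L} <= n.+1)%N.
Proof.
pose p : {poly L} := \sum_(i < n.+2) 'X^i.
have szp : size p = n.+2.
  have -> : p = \poly_(i < n.+2) 1.
    by rewrite poly_def; apply: eq_bigr => i _; rewrite scale1r.
  by rewrite size_poly_eq ?oner_neq0.
have p0 : p != 0 by rewrite -size_poly_eq0 szp.
rewrite -L_gen dim_Fadjoin dimv1 muln1 -ltnS -size_minPoly -szp.
apply: dvdp_leq p0 _; apply: minPoly_dvdp.
  by apply: rpred_sum => i _; apply: rpredX; apply: polyOverX.
rewrite rootE horner_sum; under eq_bigr do rewrite hornerXn.
apply/eqP; rewrite -[RHS](sum_zeta 1).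
by apply: eq_bigr => i _; rewrite mulr1.
Qed.

(** Row freeness may be tested over L, where multiplying by the conjugates gives the Fourier matrix,
    invertible since l is nonzero in L. *)
Lemma zeta_mx_free : row_free zeta_mx.
Proof.
rewrite -(row_free_map (in_alg L)); apply/row_freeP.
exists (gal_mx *m (n.+2%:R^-1 *: fourier_inv)).
rewrite mulmxA zeta_gal_mx -scalemxAr fourierK scale_scalar_mx.
by rewrite mulVf ?natl_neq0L.
Qed.

(** The two dimensions are equal only propositionally, so the inverse is taken with [pinvmx]. *)
Definition zeta_inv : 'M[K]_(\dim {:L}, n.+1) := pinvmx zeta_mx.

Lemma zeta_mxK : zeta_mx *m zeta_inv = 1%:M.
Proof. exact: mulmxVp zeta_mx_free. Qed.

Lemma zeta_invK : zeta_inv *m zeta_mx = 1%:M.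
Proof.
apply: mulVpmx; apply/eqP; rewrite (eqP zeta_mx_free); apply/eqP.
rewrite eqn_leq dim_L_le andbT -{1}(eqP zeta_mx_free); exact: rank_leq_col.
Qed.

Definition gal_inv_mx : 'M[L]_(n.+1, \dim {:L}) :=
  n.+2%:R^-1 *: (fourier_inv *m map_mx (in_alg L) zeta_mx).

Lemma gal_mxE : gal_mx = map_mx (in_alg L) zeta_inv *m fourier_mx.
Proof.
by rewrite -zeta_gal_mx mulmxA -map_mxM zeta_invK map_mx1 mul1mx.
Qed.

Lemma gal_mxK : gal_mx *m gal_inv_mx = 1%:M.
Proof.
rewrite gal_mxE -scalemxAr mulmxA -(mulmxA _ fourier_mx) fourierK.
rewrite -mulmxA mul_scalar_mx -scalemxAr scalerA mulVf ?natl_neq0L //.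
by rewrite scale1r -map_mxM zeta_invK map_mx1.
Qed.

Lemma gal_inv_mxK : gal_inv_mx *m gal_mx = 1%:M.
Proof.
rewrite -scalemxAl -mulmxA zeta_gal_mx scalemxAl; apply: mulmx1C.
by rewrite -scalemxAr fourierK scale_scalar_mx mulVf ?natl_neq0L.
Qed.

(** * Coordinates on the tensor product along the powers of zeta *)

Section Points.

Variable A : comAlgType K.
Local Notation zt k := (tens_in A (zeta ^+ (k : 'Z_n.+2)%R)).
Local Notation ZA := (map_mx (in_alg A) zeta_mx).
Implicit Types (x y : 'rV[A]_n.+1) (u v : tens L A).

Lemma sum_tens_zeta : \sum_k zt k = 0.
Proof.
rewrite -raddf_sum -[RHS](raddf0 (@tens_in K L A)); congr tens_in.
by rewrite -[RHS](sum_zeta 1); apply: eq_bigr => k _; rewrite mulr1.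
Qed.

Lemma mul_zeta_mx x : x *m ZA = \sum_i x 0 i *: zt (lift ord0 i) :> tens L A.
Proof.
by apply/rowP=> j; rewrite mxE summxE; apply: eq_bigr => i _; rewrite !mxE.
Qed.

Lemma mul_zeta_mx_inj : injective (fun x => x *m ZA).
Proof.
move=> x y /(congr1 (fun u => u *m map_mx (in_alg A) zeta_inv)).
by rewrite -!mulmxA -map_mxM zeta_mxK map_mx1 !mulmx1.
Qed.

(** The vanishing of the sum of all powers of zeta eliminates zeta^0, at the cost of subtracting
    [c 0] from the other coefficients. *)
Lemma sum_zetaE (c : 'Z_n.+2 -> A) :
  \sum_k c k *: zt k = (\row_i (c (lift ord0 i) - c 0)) *m ZA.
Proof.
rewrite mul_zeta_mx; under [RHS]eq_bigr do rewrite mxE scalerBl.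
have := sum_tens_zeta; rewrite !sum_Zl => /eqP; rewrite addr_eq0 => /eqP->.
by rewrite sumrB scalerN -scaler_sumr addrC.
Qed.

Lemma sum_zeta_eq (c d : 'Z_n.+2 -> A) :
  \sum_k c k *: zt k = \sum_k d k *: zt k <->
  forall k, c k - c 0 = d k - d 0.
Proof.
rewrite !sum_zetaE; split=> [/mul_zeta_mx_inj/rowP cd k | cd].
  case: (unliftP ord0 k) => [i|] ->; rewrite ?subrr //.
  by have := cd i; rewrite !mxE.
by congr (_ *m _); apply/rowP=> i; rewrite !mxE.
Qed.

Lemma tens_alg_sum (a : A) :
  a%:A = \sum_k (if k == 0 then a else 0) *: zt k :> tens L A.
Proof.
rewrite (bigD1 0) //= big1 => [|k /negPf->]; last by rewrite scale0r.
by rewrite addr0 expr0 rmorph1.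
Qed.

Lemma sum_zeta_alg (c : 'Z_n.+2 -> A) (a : A) :
  \sum_k c k *: zt k = a%:A <-> forall k, k != 0 -> c 0 - c k = a.
Proof.
rewrite tens_alg_sum sum_zeta_eq eqxx; split=> c_a k => [k0|].
  by rewrite -opprB c_a (negPf k0) sub0r opprK.
by case: eqVneq => [->|/c_a <-]; rewrite ?subrr // sub0r opprB.
Qed.

Variable f : nat.

Lemma alphaE x : alpha f zeta (x : 'rV_n.+2.-1) = (-1) ^+ f.-1 *: (x *m ZA).
Proof.
rewrite mul_zeta_mx /alpha.
have -> : (-1) ^+ f.-1 = ((-1) ^+ f.-1)%:A :> tens L A.
  by rewrite -[RHS]/(in_alg (tens L A) _) rmorphXn /= scaleN1r.
exact: mulr_algl.
Qed.

Lemma alpha_sum x : alpha f zeta (x : 'rV_n.+2.-1) =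
  (-1) ^+ f.-1 *: \sum_k @xcoord n.+2 A x k *: zt k.
Proof.
rewrite alphaE mul_zeta_mx sum_Zl xcoord0 scale0r add0r; congr (_ *: _).
by apply: eq_bigr => i _; rewrite xcoord_lift.
Qed.

(** The product of the two sums has the cyclic convolution [c] as coefficients. Reduction to the
    nonzero powers of zeta subtracts [c 0], the second sum in [conv]; of the two signs, one goes to
    [alpha] and one to [conv]. *)
Lemma alpha_conv x y :
  alpha f zeta (conv f (x : 'rV_n.+2.-1) y) =
  alpha f zeta (x : 'rV_n.+2.-1) * alpha f zeta (y : 'rV_n.+2.-1).
Proof.
pose c (k : 'Z_n.+2) := \sum_i @xcoord n.+2 A x i * @xcoord n.+2 A y (k - i).
have -> : alpha f zeta (x : 'rV_n.+2.-1) * alpha f zeta (y : 'rV_n.+2.-1) =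
    ((-1) ^+ f.-1 * (-1) ^+ f.-1) *: \sum_k c k *: zt k.
  rewrite !alpha_sum -scalerAl -tens_scalerAr scalerA; congr (_ *: _).
  rewrite mulr_suml; under [RHS]eq_bigr do rewrite scaler_suml.
  rewrite [RHS]exchange_big; apply: eq_bigr => i _ /=.
  rewrite mulr_sumr [RHS](reindex_inj (addIr i)); apply: eq_bigr => k _ /=.
  by rewrite -scalerAl -tens_scalerAr scalerA -rmorphM -zetaD [i + _]addrC
    addrK.
rewrite alpha_sum -scalerA; congr (_ *: _).
rewrite scaler_sumr; under [RHS]eq_bigr do rewrite scalerA.
apply/sum_zeta_eq => k; rewrite xcoord0 subr0 -mulrBr.
case: (unliftP ord0 k) => [i|] ->; last by rewrite subrr mulr0.
rewrite xcoord_lift mxE Zl_nat; congr (_ * (_ - _)).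
  (* The term at 0, which [conv] omits, vanishes because x_0 = 0. *)
  by rewrite /c [RHS](bigD1 0) //= xcoord0 mul0r add0r.
rewrite /c [RHS](bigD1 0) //= xcoord0 mul0r add0r.
by apply: eq_bigr => k' _; rewrite sub0r.
Qed.

End Points.

Lemma zeta_sum (I : Type) (r : seq I) (F : I -> 'Z_n.+2) :
  zeta ^+ (\sum_(i <- r) F i : 'Z_n.+2)%R = \prod_(i <- r) zeta ^+ F i.
Proof.
by apply: (big_morph (fun k : 'Z_n.+2 => zeta ^+ k)) => /=; [exact: zetaD|].
Qed.

(** * Norms of alpha *)

Section Norm.

(** L/M is cyclic of degree [N]. Two cases will be needed: the field [fixed_by] with [N = f], and
    [1%VS] with [N = n.+1]; here [f] governs the sign in [alpha]. *)
Variables (A : comAlgType K) (f N : nat) (M : {vspace L}).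
Variables (s : gal_of {:L}) (g : {unit 'Z_n.+2}).
Hypothesis s_zeta : s zeta = zeta ^+ (val g : 'Z_n.+2).
Hypothesis Gal_M : ('Gal({:L} / M) = <[s]>)%g.
Hypothesis order_s : #[s]%g = N.
Hypothesis even_sign : ~~ odd (f.-1 * N).
Local Notation zt k := (tens_in A (zeta ^+ (k : 'Z_n.+2)%R)).
Implicit Type x : 'rV[A]_n.+1.

Lemma gal_tens_zeta j k :
  tens_gal (s ^+ j)%g (zt k) = zt (val g ^+ j * k).
Proof.
rewrite tens_gal_in zetaM rmorphXn /= (galX_zeta j s_zeta).
congr (tens_in A ((zeta ^+ _) ^+ _)).
by congr nat_of_ord; elim: j => // j IHj; rewrite expgS exprS -IHj.
Qed.

(** Conjugation by [s ^+ j] multiplies the exponents of zeta by [g ^+ j]. Expanding the product over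
    all choices of indices and grouping by total exponent gives T; the [N] signs have product 1 by
    [even_sign]. *)
Lemma norm_alpha x : tens_norm M (alpha f zeta (x : 'rV_n.+2.-1)) =
  \sum_t Tsum N g t (x : 'rV_n.+2.-1) *: zt t.
Proof.
rewrite (tens_norm_cycle _ Gal_M) order_s.
transitivity (\prod_(j < N) ((in_alg (tens L A) ((-1) ^+ f.-1)) *
    \sum_k @xcoord n.+2 A x k *: zt (val g ^+ j * k))).
  apply: eq_bigr => j _; rewrite alpha_sum tens_galZ mulr_algl; congr (_ *: _).
  rewrite raddf_sum; apply: eq_bigr => k _.
  by rewrite /= tens_galZ gal_tens_zeta.
rewrite big_split /= prodr_const card_ord.
rewrite -[_%:A]/(in_alg (tens L A) _) -rmorphXn.
rewrite -exprM -signr_odd (negPf even_sign) rmorph1 mul1r bigA_distr_bigA /=.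
rewrite [LHS](partition_big
  (fun i : {ffun 'I_N -> 'Z_n.+2} => \sum_(j < N) val g ^+ j * i j) predT) //=.
apply: eq_bigr => t _; rewrite scaler_suml; apply: eq_bigr => i /eqP <-.
rewrite zeta_sum rmorph_prod -[RHS]mulr_algl -[_%:A]/(in_alg (tens L A) _).
rewrite rmorph_prod -big_split; apply: eq_bigr => j _ /=.
by rewrite mulr_algl.
Qed.

(** The norm is fixed by [s], which multiplies exponents by [g]. Comparing coefficients leaves T_0
    subtracted on both sides, as the exponent 0 is fixed, and it cancels. *)
Lemma Tsum_mul x (t : 'Z_n.+2) :
  Tsum N g (val g * t) (x : 'rV_n.+2.-1) = Tsum N g t (x : 'rV_n.+2.-1).
Proof.
have Gs : s \in 'Gal({:L} / M)%g by rewrite Gal_M cycle_id.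
have := tens_gal_norm (alpha f zeta (x : 'rV_n.+2.-1)) Gs.
have -> : tens_gal s (tens_norm M (alpha f zeta (x : 'rV_n.+2.-1))) =
    \sum_k Tsum N g k (x : 'rV_n.+2.-1) *: zt (val g * k).
  rewrite norm_alpha raddf_sum; apply: eq_bigr => k _.
  by rewrite /= tens_galZ -[s in tens_gal s]expg1 gal_tens_zeta expr1.
rewrite norm_alpha => Teq.
pose h := val g^-1%g : 'Z_n.+2.
have gh k : val g * (h * k) = k.
  by rewrite mulrA -[val g * h]/(val (g * g^-1)%g) mulgV mul1r.
have hg k : h * (val g * k) = k by rewrite mulrCA gh.
have /sum_zeta_eq/(_ (val g * t)) :
    \sum_k Tsum N g (h * k) (x : 'rV_n.+2.-1) *: zt k =
    \sum_k Tsum N g k (x : 'rV_n.+2.-1) *: zt k.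
  rewrite (reindex_inj (mulrI (valP g))) /= -Teq.
  by apply: eq_bigr => k _; rewrite hg.
by rewrite hg mulr0 => /addIr.
Qed.

End Norm.

(** * The norms to K and to M, and the points of W *)

Section FullNorm.

Hypothesis l_odd : odd n.+2.
Hypothesis Gal_s0 : ('Gal({:L} / 1) = <[s0]>)%g.
Variables (A : comAlgType K) (f : nat).
Implicit Type x : 'rV[A]_n.+1.

Lemma order_s0 : #[s0]%g = n.+1.
Proof. by rewrite (order_gal s0_zeta) (order_gamma l_prime gamma_gen). Qed.

Lemma even_full_sign : ~~ odd (f.-1 * n.+1).
Proof. by rewrite oddM negb_and; move: l_odd => /= ->; rewrite orbT. Qed.

(** The norm from L to K as a polynomial in the coordinates; [R] is arbitrary so that it can also be
    taken at the generic point. *)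
Definition full_norm (R : comNzRingType) (x : 'rV[R]_n.+1) : R :=
  Tsum n.+1 gamma 0 (x : 'rV_n.+2.-1) - Tsum n.+1 gamma 1 (x : 'rV_n.+2.-1).

(** [gamma] carries 1 to every nonzero residue, so by [Tsum_mul] all T_k with k nonzero equal
    T_1. *)
Lemma full_normE x :
  tens_norm 1%VS (alpha f zeta (x : 'rV_n.+2.-1)) = (full_norm x)%:A.
Proof.
rewrite (norm_alpha s0_zeta Gal_s0 order_s0 even_full_sign).
apply/sum_zeta_alg => k /(gamma_exp l_prime gamma_gen)[m ->]; congr (_ - _).
elim: m => [|m IHm] //; rewrite expgS -IHm.
exact: (Tsum_mul s0_zeta Gal_s0 order_s0 even_full_sign).
Qed.

Lemma in_Gm_alpha x :
  in_Gm (tens_norm 1%VS (alpha f zeta (x : 'rV_n.+2.-1))) <->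
  invertible (alpha f zeta (x : 'rV_n.+2.-1)).
Proof.
split=> [[a aU Na] | /(invertible_tens_norm 1%VS)].
  apply/(invertible_tens_norm 1%VS); rewrite Na.
  exact/invertible_tens_alg.
by rewrite full_normE => /invertible_tens_alg dU; exists (full_norm x).
Qed.

Lemma in_Gm_full_norm x :
  in_Gm (tens_norm 1%VS (alpha f zeta (x : 'rV_n.+2.-1))) <->
  invertible (full_norm x).
Proof.
rewrite full_normE; split=> [[a aU] | dU]; last by exists (full_norm x).
by move/tens_alg_inj->.
Qed.

Variable e : nat.
Hypothesis e_f : n.+1 = (e * f)%N.

Local Notation M := (@fixed_by K L zeta n.+2 (gamma ^+ e)%g).

(** As zeta generates L, the generating set in [fixed_by] is the singleton of [s0 ^+ e]; the Galois
    correspondence concludes. *)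
Lemma Gal_fixed_by : ('Gal({:L} / M) = <[s0 ^+ e]>)%g.
Proof.
rewrite /fixed_by gal_generated genGid; congr <<_>>%g.
apply/setP=> s; rewrite !inE; apply/andP/eqP=> [[_ /eqP s_zeta] | ->].
  by apply: gal_zeta_inj; rewrite (galX_zeta e s0_zeta).
by rewrite Gal_s0 mem_cycle (galX_zeta e s0_zeta).
Qed.

Lemma ef_gt0 : (0 < e)%N && (0 < f)%N.
Proof. by rewrite -muln_gt0 -e_f. Qed.

Lemma order_s0e : #[(s0 ^+ e)%g]%g = f.
Proof.
have /andP[e0 f0] := ef_gt0.
by rewrite orderXdiv order_s0 e_f ?dvdn_mulr // mulKn.
Qed.

Lemma even_pred_mul : ~~ odd (f.-1 * f).
Proof. by case: f => // f'; rewrite /= oddM /=; case: odd. Qed.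

(** The equations link the exponents 1 to [e] of [gamma], and the periodicity [T_e] reaches all
    others; [sum_zeta_alg] then turns equality of the T at nonzero residues into a scalar norm. *)
Lemma hpoly_norm x :
  (forall m, (1 <= m <= e.-1)%N -> hpoly e f gamma m (x : 'rV_n.+2.-1) = 0) <->
  exists a : A, tens_norm M (alpha f zeta (x : 'rV_n.+2.-1)) = a%:A.
Proof.
have /andP[e0 f0] := ef_gt0.
have s_zeta := galX_zeta e s0_zeta.
rewrite (norm_alpha s_zeta Gal_fixed_by order_s0e even_pred_mul).
pose T (m : nat) :=
  Tsum f (gamma ^+ e)%g (val (gamma ^+ m)%g) (x : 'rV_n.+2.-1).
have hpolyE m : hpoly e f gamma m (x : 'rV_n.+2.-1) = T m - T m.+1 by [].
have T_e m : T (m + e)%N = T m.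
  rewrite /T addnC expgD.
  exact: (Tsum_mul s_zeta Gal_fixed_by order_s0e even_pred_mul).
split=> [hx | [a /sum_zeta_alg Ta] m _]; last first.
  rewrite hpolyE; apply/eqP; rewrite subr_eq0; apply/eqP.
  have Tm m' : Tsum f (gamma ^+ e)%g 0 (x : 'rV_n.+2.-1) - T m' = a.
    by apply: Ta; exact: Zl_unit_neq0.
  apply/oppr_inj/(addrI (Tsum f (gamma ^+ e)%g 0 (x : 'rV_n.+2.-1))).
  by rewrite !Tm.
have T_small m : (m < e)%N -> T m.+1 = T 1%N.
  elim: m => // m IHm lt_m; rewrite -IHm 1?ltnW //.
  have: hpoly e f gamma m.+1 (x : 'rV_n.+2.-1) = 0.
    by apply: hx; rewrite /= -ltnS prednK.
  by rewrite hpolyE => /subr0_eq.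
(* Exponents above [e] are lowered by [e]; the exponent 0, missed by the chain from 1 to [e], is
   raised to [e]. *)
have T_all m : T m = T 1%N.
  elim/ltn_ind: m => m IHm; case: (leqP e.+1 m) => [lt_em | le_me].
    rewrite -(subnK (ltnW lt_em)) T_e IHm //.
    by rewrite ltn_subrL e0 (leq_trans _ lt_em).
  case: m {IHm} le_me => [_ | m]; last by rewrite ltnS; exact: T_small.
  by rewrite -T_e add0n -{1}(prednK e0) T_small // prednK.
exists (Tsum f (gamma ^+ e)%g 0 (x : 'rV_n.+2.-1) - T 1%N).
apply/sum_zeta_alg => k /(gamma_exp l_prime gamma_gen)[m ->].
by rewrite -/(T m) T_all.
Qed.

(** The equations make the norm to M a scalar [a], and the open condition makes alpha invertible;
    then [a] is invertible, being the norm of a unit. *)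
Lemma W_alpha x :
  apt (W e f gamma zeta) (x : 'rV_n.+2.-1) <->
  apt (norm_torus M) (alpha f zeta (x : 'rV_n.+2.-1)).
Proof.
rewrite /= hpoly_norm in_Gm_alpha; split=> [[[a Na] xU] | [xU [a aU Na]]].
  split=> //; exists a => //; apply/(@invertible_tens_alg K L).
  by rewrite -Na; apply/invertible_tens_norm.
by split=> //; exists a.
Qed.

End FullNorm.

(** * The isomorphism *)

Section AlgebraicGroups.

Hypothesis l_odd : odd n.+2.
Hypothesis Gal_s0 : ('Gal({:L} / 1) = <[s0]>)%g.
Variables (e f : nat).
Hypothesis e_f : n.+1 = (e * f)%N.

Local Notation M := (@fixed_by K L zeta n.+2 (gamma ^+ e)%g).

Definition alpha_inv_mx : 'M[K]_(\dim {:L}, n.+1) := (-1) ^+ f.-1 *: zeta_inv.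

Lemma alphaVK (A : comAlgType K) (u : tens L A) :
  alpha f zeta (u *m map_mx (in_alg A) alpha_inv_mx : 'rV_n.+2.-1) = u.
Proof.
rewrite alphaE -mulmxA -map_mxM -scalemxAl zeta_invK scale_scalar_mx mulr1.
rewrite map_scalar_mx mul_mx_scalar scalerA rmorphXn rmorphN1.
by rewrite -expr2 sqrr_sign scale1r.
Qed.

Lemma alphaK (A : comAlgType K) (x : 'rV[A]_n.+1) :
  alpha f zeta (x : 'rV_n.+2.-1) *m map_mx (in_alg A) alpha_inv_mx = x.
Proof.
rewrite alphaE -scalemxAl -mulmxA -map_mxM -scalemxAr zeta_mxK.
rewrite scale_scalar_mx mulr1.
rewrite map_scalar_mx mul_mx_scalar scalerA rmorphXn rmorphN1.
by rewrite -expr2 sqrr_sign scale1r.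
Qed.

Lemma alpha_map (A B : comAlgType K) (phi : {lrmorphism A -> B})
    (x : 'rV[A]_n.+1) :
  map_mx phi (alpha f zeta (x : 'rV_n.+2.-1)) =
  alpha f zeta (map_mx phi x : 'rV_n.+2.-1).
Proof.
rewrite !alphaE map_mxZ rmorphXn rmorphN1 map_mxM; congr (_ *: (_ *m _)).
by apply/matrixP=> i j; rewrite !mxE /= linearZ rmorph1.
Qed.

(** The defining polynomials are [hpoly] and [full_norm] at the generic point [X]: both commute with
    evaluation morphisms. *)
Lemma W_locally_closed : locally_closed (W e f gamma zeta).
Proof.
pose X : 'rV[{mpoly K[n.+1]}]_n.+1 := \row_i 'X_i.
exists [seq hpoly e f gamma m (X : 'rV_n.+2.-1) | m <- iota 1 e.-1].
exists (full_norm X) => A x /=.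
have map_X : map_mx (mmap (in_alg A) (x 0)) X = x.
  by apply/rowP=> i; rewrite !mxE mmapX mmap1U.
rewrite (in_Gm_full_norm l_odd Gal_s0).
have ev_norm : mmap (in_alg A) (x 0) (full_norm X) = full_norm x.
  by rewrite -[in RHS]map_X /full_norm !Tsum_map -rmorphB.
split=> -[hx dU]; split.
- move=> _ /mapP[m + ->]; rewrite mem_iota add1n => /andP[m1 me].
  rewrite -[LHS](hpoly_map (mmap (in_alg A) (x 0))) map_X; apply: hx.
  by rewrite m1 -ltnS.
- by rewrite -ev_norm in dU.
- move=> m /andP[m1 me]; rewrite -map_X hpoly_map; apply: hx.
  by apply: map_f; rewrite mem_iota m1 add1n ltnS.
by rewrite -ev_norm.
Qed.

(** The torus is the preimage of [W] under the K-linear inverse of [alpha]. *)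
Lemma norm_torus_locally_closed : locally_closed (norm_torus M).
Proof.
apply: (@locally_closed_linear K (W e f gamma zeta) (norm_torus M) alpha_inv_mx)
  _ W_locally_closed.
by move=> A u; rewrite (W_alpha l_odd Gal_s0 e_f) alphaVK.
Qed.

Lemma norm_torus_group : algebraic_group (norm_torus M).
Proof. exact: norm_torus_algebraic_group norm_torus_locally_closed. Qed.

Lemma W_isomorphic : isomorphic (W e f gamma zeta) (norm_torus M).
Proof.
exists (fun A x => alpha f zeta x).
exists (fun A u => u *m map_mx (in_alg A) alpha_inv_mx).
split=> [A x Wx | A u Mu | A x y _ _ | A B phi x _].
- by split; [apply/(W_alpha l_odd Gal_s0 e_f) | exact: alphaK].
- rewrite alphaVK; split=> //.
  by apply/(W_alpha l_odd Gal_s0 e_f); rewrite alphaVK.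
- exact: alpha_conv.
exact: alpha_map.
Qed.

Lemma W_group : algebraic_group (W e f gamma zeta).
Proof.
apply: algebraic_group_isomorphic W_locally_closed _ _ W_isomorphic
  norm_torus_group.
  by move=> A B phi x y _ _; exact: conv_map.
move=> A x y /(W_alpha l_odd Gal_s0 e_f) Wx /(W_alpha l_odd Gal_s0 e_f) Wy.
by apply/(W_alpha l_odd Gal_s0 e_f); rewrite alpha_conv; exact: norm_torus_mul.
Qed.

End AlgebraicGroups.

(** * Splitting the norm torus over L *)

Section Splitting.

Hypothesis Gal_s0 : ('Gal({:L} / 1) = <[s0]>)%g.
Variables (e f : nat).
Hypothesis e_f : n.+1 = (e * f)%N.

Local Notation M := (@fixed_by K L zeta n.+2 (gamma ^+ e)%g).
(** The rank l - e counts the free coordinates: the index 0 and those from [e] to [n]. *)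
Local Notation r := (n.+2 - e)%N.

Lemma e_gt0 : (0 < e)%N.
Proof. by case/andP: (ef_gt0 e_f). Qed.

Lemma le_e : (e <= n.+1)%N.
Proof. by case/andP: (ef_gt0 e_f) => _ f0; rewrite e_f leq_pmulr. Qed.

(* Over L the torus consists of the units (v_m), m < ef, whose products over the
   classes mod e all agree; the v_m with m = 0 or m >= e determine the others. *)
Definition free_index (i : nat) : nat := if i is 0 then 0 else (i + e.-1)%N.

Lemma free_indexK i : (free_index i - e.-1)%N = i.
Proof. by case: i => [|i]; rewrite ?sub0n // addnK. Qed.

Lemma free_index_bound (i : 'I_r) : (free_index i < n.+1)%N.
Proof.
have e0 := e_gt0; have le_en := le_e.
by case: i => [[|i] lt_i] //=; lia.
Qed.

Lemma free_index_free (i : nat) : ~~ (0 < free_index i < e)%N.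
Proof.
by have e0 := e_gt0; case: i => //= i; lia.
Qed.

Section TorusCoordinates.

Variable A : comAlgType K.
Implicit Types (y : 'rV[A]_r) (a : A).

Lemma prod_recl (F : nat -> A) :
  \prod_(j < f) F j = F 0 * \prod_(j < f.-1) F j.+1.
Proof.
by case/andP: (ef_gt0 e_f) => _; case: (f) => // f' _; rewrite big_ord_recl.
Qed.

(** A [comAlgType] has no inverse operation, so an inverse is chosen by [epsilon]; it is unique
    whenever it exists. *)
Definition some_inverse a : A := epsilon (inhabits 0) (fun a' => a * a' = 1).

Lemma some_inverseP a : invertible a -> a * some_inverse a = 1.
Proof. exact: epsilon_spec. Qed.

Lemma invertible_some_inverse a : invertible a -> invertible (some_inverse a).
Proof. by move=> aU; exists a; rewrite mulrC some_inverseP. Qed.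

(** Truncated subtraction inverts [free_index] at 0 and from [e] on. The default 1 is taken only for
    [m] above [n], and keeps every value invertible. *)
Definition free_coord y (m : nat) : A :=
  oapp (fun i => y 0 i) 1 (insub (m - e.-1)%N).

(** For 0 < m < e, the equality of the products over the classes of m and 0 is solved for the
    coordinate at m. *)
Definition torus_coord y (m : nat) : A :=
  if (0 < m < e)%N then
    (\prod_(j < f) free_coord y (e * j)) *
    some_inverse (\prod_(j < f.-1) free_coord y (m + e * j.+1))
  else free_coord y m.

Lemma torus_coord_free y (i : 'I_r) : torus_coord y (free_index i) = y 0 i.
Proof.
rewrite /torus_coord (negPf (free_index_free i)) /free_coord free_indexK.
by rewrite valK.
Qed.

Variable y : 'rV[A]_r.
Hypothesis yU : forall i, invertible (y 0 i).

Lemma free_coord_invertible m : invertible (free_coord y m).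
Proof.
by rewrite /free_coord; case: insub => [i|]; [exact: yU | exact: invertible1].
Qed.

Lemma torus_coord_invertible m : invertible (torus_coord y m).
Proof.
rewrite /torus_coord; case: ifP => _; last exact: free_coord_invertible.
apply: invertibleM; last apply: invertible_some_inverse;
  by apply: invertible_prod => j _; exact: free_coord_invertible.
Qed.

(** Only the factor at [j = 0] can be a solved coordinate, and its denominator cancels the other
    factors; in the class of 0 all factors are free. *)
Lemma prod_torus_coord c : (c < e)%N ->
  \prod_(j < f) torus_coord y (c + e * j) = \prod_(j < f) free_coord y (e * j).
Proof.
have ej_free m j : (0 < j)%N ->
    torus_coord y (m + e * j) = free_coord y (m + e * j).
  move=> j0; have le_e : (e <= m + e * j)%N.
    by apply: leq_trans (leq_addl m _); rewrite leq_pmulr.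
  by rewrite /torus_coord [(_ < e)%N]ltnNge le_e andbF.
case: c => [_ | c lt_ce].
  apply: eq_bigr => -[[|j] ltj] _; last by rewrite ej_free.
  by rewrite /torus_coord /= muln0.
rewrite (prod_recl (fun j => torus_coord y (c.+1 + e * j))) muln0 addn0.
under eq_bigr do rewrite ej_free //.
rewrite {1}/torus_coord lt_ce /= -mulrA [some_inverse _ * _]mulrC.
by rewrite some_inverseP ?mulr1 //; apply: invertible_prod => j _;
  exact: free_coord_invertible.
Qed.

End TorusCoordinates.

(** * Components of the tensor product over an L-algebra *)

Section OverL.

Variables (A : comAlgType K) (iota : {lrmorphism L -> A}).
Implicit Types (u v : tens L A) (y : 'rV[A]_r).
Local Notation ev m := (tens_eval iota (s0 ^+ m)%g).

Lemma mul_gal_mx u : u *m map_mx iota gal_mx = \row_(m < n.+1) ev m u.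
Proof. by apply/rowP=> m; rewrite !mxE; apply: eq_bigr => i _; rewrite !mxE. Qed.

(** The matrix of conjugates is invertible, so equalities can be tested on components. *)
Lemma tens_eval_inj u v : (forall m, (m < n.+1)%N -> ev m u = ev m v) -> u = v.
Proof.
move=> uv; have : u *m map_mx iota gal_mx = v *m map_mx iota gal_mx.
  by rewrite !mul_gal_mx; apply/rowP=> m; rewrite !mxE uv.
move/(congr1 (fun w => w *m map_mx iota gal_inv_mx)).
by rewrite -!mulmxA -map_mxM gal_mxK map_mx1 !mulmx1.
Qed.

Lemma tens_eval_gal_inv (v : 'rV[A]_n.+1) (m : 'I_n.+1) :
  ev m (v *m map_mx iota gal_inv_mx) = v 0 m.
Proof.
have := mul_gal_mx (v *m map_mx iota gal_inv_mx).
rewrite -mulmxA -map_mxM gal_inv_mxK map_mx1 mulmx1 => /rowP/(_ m) ->.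
by rewrite mxE.
Qed.

(** The powers of [s0 ^+ e] move the component at [m] through its class mod [e]. *)
Lemma tens_eval_norm m u :
  ev m (tens_norm M u) = \prod_(j < f) ev (m + e * j)%N u.
Proof.
rewrite (tens_norm_cycle _ (Gal_fixed_by Gal_s0 e)) (order_s0e e_f) rmorph_prod.
by apply: eq_bigr => j _; rewrite /= tens_eval_gal -expgM -expgD addnC.
Qed.

(** The norm is fixed by [s0 ^+ e]. Reducing [m] mod [e] keeps the indices [m + e * j] below [n.+1],
    the range of [eval_torus_of_params]. *)
Lemma tens_eval_norm_mod m u :
  ev m (tens_norm M u) = ev (m %% e)%N (tens_norm M u).
Proof.
have Gs : (s0 ^+ (e * (m %/ e)))%g \in 'Gal({:L} / M)%g.
  by rewrite (Gal_fixed_by Gal_s0 e) expgM mem_cycle.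
rewrite {1}(divn_eq m e) mulnC expgD -tens_eval_gal.
by rewrite (tens_gal_norm u Gs).
Qed.

Definition torus_params u : 'rV[A]_r := \row_i ev (free_index i) u.

Definition torus_of_params y : tens L A :=
  (\row_(m < n.+1) torus_coord y m) *m map_mx iota gal_inv_mx.

Lemma eval_torus_of_params y m : (m < n.+1)%N -> ev m (torus_of_params y) = torus_coord y m.
Proof. by move=> lt_m; rewrite (tens_eval_gal_inv _ (Ordinal lt_m)) mxE. Qed.

Lemma torus_of_paramsK y : torus_params (torus_of_params y) = y.
Proof.
apply/rowP=> i; rewrite mxE eval_torus_of_params ?free_index_bound //.
exact: torus_coord_free.
Qed.

Lemma torus_of_params_in y :
  (forall i, invertible (y 0 i)) -> apt (norm_torus M) (torus_of_params y).
Proof.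
move=> yU; split.
  pose v := \row_(m < n.+1) some_inverse (torus_coord y m).
  exists (v *m map_mx iota gal_inv_mx).
  apply: tens_eval_inj => m lt_m; rewrite rmorphM /= eval_torus_of_params //.
  rewrite (tens_eval_gal_inv _ (Ordinal lt_m)) mxE rmorph1.
  by rewrite some_inverseP //; exact: torus_coord_invertible.
exists (\prod_(j < f) free_coord y (e * j)).
  by apply: invertible_prod => j _; exact: free_coord_invertible.
apply: tens_eval_inj => m _; rewrite tens_eval_alg tens_eval_norm_mod.
have lt_me : (m %% e < e)%N by rewrite ltn_mod e_gt0.
rewrite tens_eval_norm -(prod_torus_coord yU lt_me); apply: eq_bigr => j _.
rewrite eval_torus_of_params // e_f; apply: (@leq_trans (e * j.+1)).
  by rewrite mulnS ltn_add2r.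
by rewrite leq_mul2l ltn_ord orbT.
Qed.

Lemma torus_params_invertible u :
  apt (norm_torus M) u -> forall i, invertible (torus_params u 0 i).
Proof. by move=> [uU _] i; rewrite mxE; exact: invertible_rmorph. Qed.

Lemma free_coord_th u m : (m < n.+1)%N -> ~~ (0 < m < e)%N ->
  free_coord (torus_params u) m = ev m u.
Proof.
move=> lt_m m_free.
have lt_r : (m - e.-1 < r)%N.
  by have e0 := e_gt0; have le_en := le_e; lia.
rewrite /free_coord insubT /= mxE; congr tens_eval; congr (_ ^+ _)%g => /=.
have e0 := e_gt0; rewrite /free_index.
by case def_k: (m - e.-1)%N => [|k]; lia.
Qed.

(** All class products equal the scalar norm [a]. The component at [m] times the rest [P] of its
    class is [a], so dividing by [P] returns the component. *)
Lemma torus_coord_th u m :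
  apt (norm_torus M) u -> (m < n.+1)%N -> torus_coord (torus_params u) m = ev m u.
Proof.
move=> Mu lt_m; have [uU [a aU Na]] := Mu.
have evN (k : nat) : \prod_(j < f) ev (k + e * j)%N u = a.
  by rewrite -tens_eval_norm Na tens_eval_alg.
rewrite /torus_coord; case: ifPn => [/andP[m0 lt_me] | ]; last first.
  exact: free_coord_th.
have index_lt c j : (c < e)%N -> (j < f)%N -> (c + e * j < n.+1)%N.
  move=> lt_c lt_j; rewrite e_f; apply: (@leq_trans (e * j.+1)).
    by rewrite mulnS ltn_add2r.
  by rewrite leq_mul2l lt_j orbT.
have -> : \prod_(j < f) free_coord (torus_params u) (e * j) = a.
  rewrite -(evN 0); apply: eq_bigr => j _; rewrite add0n free_coord_th //.
    by rewrite -[(e * j)%N]add0n index_lt ?e_gt0.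
  by case: (j : nat) => [|j']; rewrite ?muln0 // mulnS; lia.
set P := \prod_(j < f.-1) _.
have def_P : P = \prod_(j < f.-1) ev (m + e * j.+1)%N u.
  apply: eq_bigr => j _; rewrite free_coord_th //.
    by apply: index_lt => //; have := ltn_ord j; lia.
  by rewrite mulnS; lia.
have PU : invertible P.
  by rewrite def_P; apply: invertible_prod => j _; exact: invertible_rmorph.
have <- : ev m u * P = a.
  rewrite -(evN m) def_P (prod_recl (fun j => ev (m + e * j)%N u)).
  by rewrite muln0 addn0.
by rewrite -mulrA some_inverseP // mulr1.
Qed.

Lemma torus_paramsK u : apt (norm_torus M) u -> torus_of_params (torus_params u) = u.
Proof.
move=> Mu; apply: tens_eval_inj => m lt_m.
by rewrite eval_torus_of_params // torus_coord_th.
Qed.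

End OverL.

Lemma norm_torus_split : isomorphic_over L (norm_torus M) (split_torus K r).
Proof.
exists torus_params; exists torus_of_params.
split=> [A iota u Mu | A iota y yU | A iota u v _ _ | A B iA iB phi iAB u _].
- by split; [exact: torus_params_invertible | exact: torus_paramsK].
- by split; [exact: torus_of_params_in | exact: torus_of_paramsK].
- by apply/rowP=> i; rewrite !mxE; exact: rmorphM.
apply/rowP=> i; rewrite !mxE rmorph_sum; apply: eq_bigr => k _.
by rewrite rmorphM /= iAB mxE.
Qed.

End Splitting.

End Cyclotomic.

Theorem theorem1p6 (e f l : nat) (K : fieldType) (L : splittingFieldType K)
    (zeta : L) (gamma : {unit 'Z_l})
    (f_ge2 : (2 <= f)%N) (l_prime : prime l) (l_odd : odd l)
    (l_def : l = (e * f + 1)%N)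
    (char_f : forall p : nat, p \in [pchar K] -> ~~ (p %| f`!)%N)
    (char_l : l \notin [pchar K])
    (zeta_prim : l.-primitive_root zeta) (L_gen : <<1; zeta>>%VS = fullv)
    (Gal_L : ('Gal({:L} / 1) \isog units_Zp l)%g)
    (gamma_gen : <[gamma]>%g = units_Zp l) :
  let M := fixed_by zeta (gamma ^+ e)%g in
  algebraic_group (W e f gamma zeta)
  /\ algebraic_torus (norm_torus M)
  /\ isomorphic (W e f gamma zeta) (norm_torus M).
Proof.
case: l gamma l_prime l_odd l_def char_l zeta_prim Gal_L gamma_gen =>
  [|[|n]] // gamma l_prime l_odd l_def char_l zeta_prim Gal_L gamma_gen M.
have e_f : n.+1 = (e * f)%N by apply: succn_inj; rewrite l_def addn1.
have [s0 [s0_zeta Gal_s0]] := gal_gamma l_prime zeta_prim L_gen gamma_gen Gal_L.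
have groupW := W_group l_prime char_l zeta_prim L_gen gamma_gen s0_zeta
  l_odd Gal_s0 e_f.
have groupM := norm_torus_group l_prime char_l zeta_prim L_gen gamma_gen s0_zeta
  l_odd Gal_s0 e_f.
have isoWM := W_isomorphic l_prime char_l zeta_prim L_gen gamma_gen s0_zeta
  l_odd Gal_s0 e_f.
split=> //; split=> //; split=> //; exists (n.+2 - e)%N, L.
exact (norm_torus_split l_prime char_l zeta_prim L_gen gamma_gen s0_zeta
  Gal_s0 e_f).
Qed.
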